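(* Let $G$ be a triangle-free regular graph and let $k < \Delta(G)$. Suppose every edge precoloring of $G$ with colors from $\{1,\dots,\chi'(G)\}$ whose precolored edges are at most $k$ independent edges is extendable to a proper $\chi'(G)$-edge coloring of $G$. Then every edge precoloring of $G \square K_2$ with colors from $\{1,\dots,\chi'(G)+1\}$ whose precolored edges are at most $k+1$ independent edges is extendable to a proper $(\chi'(G)+1)$-edge coloring of $G \square K_2$.
   Context: $G \square H$ denotes the cartesian product of graphs. $\chi'(G)$ is the chromatic index and $\Delta(G)$ the maximum degree. Independent edges means pairwise non-adjacent edges (a matching). An edge precoloring is a proper edge coloring of some subset of the edges; it is extendable to a proper $t$-edge coloring if there is a proper edge coloring $f$ with colors $\{1,\dots,t\}$ agreeing with it on all precolored edges. *)

(* Defs.v *)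
From mathcomp Require Import all_boot.

Set Implicit Arguments.
Unset Strict Implicit.
Unset Printing Implicit Defensive.

Record sgraph := SGraph {
  vertex :> finType;
  adj : rel vertex;
  adj_sym : symmetric adj;
  adj_irrefl : irreflexive adj }.

Section Graphs.
Variable G : sgraph.

Definition degree (x : G) : nat := #|[set y | adj x y]|.

Definition max_degree : nat := \max_(x : G) degree x.

Definition regular : Prop := exists d, forall x : G, degree x = d.

Definition triangle_free : Prop :=
  forall x y z : G, ~ [/\ adj x y, adj y z & adj x z].

Definition edges : {set {set G}} :=
  [set e : {set G} | [exists x, exists y, adj x y && (e == [set x; y])]].

Definition edge_adj (e e' : {set G}) : bool :=
  (e != e') && ~~ [disjoint e & e'].

Definition independent_edges (S : {set {set G}}) : bool :=
  (S \subset edges) && [forall e in S, forall e' in S, ~~ edge_adj e e'].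

(* Colorings are total functions on {set G}; their values outside S are
   irrelevant. The colors are 1, ..., t. *)
Definition proper_coloring_on (S : {set {set G}}) (t : nat)
    (f : {set G} -> nat) : bool :=
  [forall e in S, 0 < f e <= t] &&
  [forall e in S, forall e' in S, edge_adj e e' ==> (f e != f e')].

Definition proper_edge_coloring (t : nat) (f : {set G} -> nat) : bool :=
  proper_coloring_on edges t f.

(* The codomain 'I_t.+1 only makes the quantification finite, hence boolean;
   see edge_colorableP. *)
Definition edge_colorable (t : nat) : bool :=
  [exists f : {ffun {set G} -> 'I_t.+1},
     proper_edge_coloring t (fun e => f e)].

Lemma edge_colorableP t :
  reflect (exists f, proper_edge_coloring t f) (edge_colorable t).
Proof.
apply: (iffP existsP) => [[f fP]|[f /andP[/forall_inP fb /forall_inP fp]]].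
  by exists (fun e => f e : nat).
pose g : {ffun {set G} -> 'I_t.+1} := [ffun e => inord (f e)].
have fE e : e \in edges -> g e = f e :> nat.
  by move=> /fb /andP[_ ft]; rewrite ffunE inordK.
exists g; apply/andP; split; apply/forall_inP => e eE; first by rewrite fE ?fb.
by apply/forall_inP => e' e'E; rewrite !fE //; apply: (forall_inP (fp e eE)).
Qed.

Lemma edge_colorable_ex : exists t, edge_colorable t.
Proof.
exists #|{: {set G}}|; apply/edge_colorableP.
exists (fun e => (enum_rank e).+1); apply/andP.
split; apply/forall_inP => e _; first exact: ltn_ord.
apply/forall_inP => e' _; apply/implyP => /andP[ne _].
by apply: contra ne => /eqP [] /val_inj /enum_rank_inj ->.
Qed.

Definition chromatic_index : nat := ex_minn edge_colorable_ex.

Definition edge_precoloring (t : nat) (S : {set {set G}})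
    (phi : {set G} -> nat) : Prop :=
  S \subset edges /\ proper_coloring_on S t phi.

Definition extendable (t : nat) (S : {set {set G}})
    (phi : {set G} -> nat) : Prop :=
  exists f : {set G} -> nat, proper_edge_coloring t f /\ {in S, f =1 phi}.

End Graphs.

Definition complete_rel (n : nat) : rel 'I_n := fun i j => i != j.

Lemma complete_sym n : symmetric (@complete_rel n).
Proof. by move=> i j; rewrite /complete_rel eq_sym. Qed.

Lemma complete_irrefl n : irreflexive (@complete_rel n).
Proof. by move=> i; rewrite /complete_rel eqxx. Qed.

Definition complete_graph (n : nat) : sgraph :=
  SGraph (@complete_sym n) (@complete_irrefl n).

Section Product.
Variables G H : sgraph.

Definition cart_rel : rel (G * H) := fun p q =>
  (p.1 == q.1) && adj p.2 q.2 || (p.2 == q.2) && adj p.1 q.1.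

Lemma cart_sym : symmetric cart_rel.
Proof.
move=> p q; rewrite /cart_rel (eq_sym p.1) (eq_sym p.2).
by rewrite (adj_sym p.1) (adj_sym p.2).
Qed.

Lemma cart_irrefl : irreflexive cart_rel.
Proof. by move=> p; rewrite /cart_rel !adj_irrefl !andbF. Qed.

Definition cart_prod : sgraph := SGraph cart_sym cart_irrefl.

End Product.

Notation "''K_' n" := (complete_graph n)
  (at level 8, n at level 2, format "''K_' n").
Notation "G □ H" := (cart_prod G H) (at level 40, left associativity).

(* Main.v *)
Require Import Defs.
From mathcomp Require Import all_boot zify.

(** Fix a color c, color both copies of G with the remaining chromatic_index G
    colors and give c to the rungs joining the two copies. On the 4-cycle above an
    edge colored alike in both copies, the two colors can be exchanged; this may be
    done simultaneously over a matching. A rung at x precolored with another color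
    than c is realized by such an exchange above an edge {x, h x} that is precolored
    with the color of the rung in both copies. The neighbors h x are chosen greedily:
    in a triangle-free graph every other precolored edge blocks at most one of the
    neighbors of x, and there are at most k < Delta(G) others. It remains that at most
    k edges are prescribed in each copy: if both copies contain precolored edges,
    take for c an unused color; if one copy contains none, take for c the color of
    some precolored edge, use one and the same coloring in both copies, and also
    exchange above the precolored edges of color c. *)

Set Implicit Arguments.
Unset Strict Implicit.
Unset Printing Implicit Defensive.

(** * Edges, independence and proper colorings seen from a vertex *)

Section Graph.
Variable G : sgraph.
Implicit Types (x y z : G) (e : {set G}) (S : {set {set G}}).

Lemma edgesP e :
  reflect (exists x y, adj x y /\ e = [set x; y]) (e \in edges G).
Proof.
rewrite inE; apply: (iffP existsP) => [[x /existsP[y /andP[xy /eqP->]]]|].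
  by exists x, y.
by move=> [x [y [xy ->]]]; exists x; apply/existsP; exists y; rewrite xy eqxx.
Qed.

Lemma mem_edges x y : adj x y -> [set x; y] \in edges G.
Proof. by move=> xy; apply/edgesP; exists x, y. Qed.

Lemma adj_neq x y : adj x y -> x != y.
Proof. by apply: contraTneq => ->; rewrite adj_irrefl. Qed.

Lemma set2_injr x y z : [set x; y] = [set x; z] -> y = z.
Proof.
move=> eq2; have: y \in [set x; z] by rewrite -eq2 set22.
have: z \in [set x; y] by rewrite eq2 set22.
by rewrite !inE => /orP[/eqP->|/eqP //] /orP[] /eqP.
Qed.

Lemma edges_mem x e :
  e \in edges G -> x \in e -> exists2 y, adj x y & e = [set x; y].
Proof.
move=> /edgesP[u [v [uv ->]]]; rewrite !inE => /orP[] /eqP->; first by exists v.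
by exists u; [rewrite adj_sym | rewrite setUC].
Qed.

Lemma edge_adjP x e e' : x \in e -> x \in e' -> edge_adj e e' = (e != e').
Proof.
move=> xe xe'; rewrite /edge_adj andbC; have -> // : ~~ [disjoint e & e'].
by apply/pred0Pn; exists x; rewrite /= xe.
Qed.

Lemma independent_edgesP S :
  reflect (S \subset edges G /\
           forall e e' x, e \in S -> e' \in S -> x \in e -> x \in e' -> e = e')
          (independent_edges S).
Proof.
apply: (iffP andP) => -[sub ind]; split=> //.
  move=> e e' x eS e'S xe xe'; apply/eqP; apply: contraTT isT => ne.
  by have /forall_inP/(_ _ e'S) := forall_inP ind _ eS; rewrite (edge_adjP xe xe') ne.
apply/forall_inP => e eS; apply/forall_inP => e' e'S; apply/andP => -[ne].
by case/pred0Pn=> x /andP[/= xe xe']; rewrite (ind e e' x) ?eqxx in ne.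
Qed.

Lemma proper_coloring_on_independent S t phi :
  independent_edges S -> (forall e, e \in S -> 0 < phi e <= t) ->
  proper_coloring_on S t phi.
Proof.
move=> /andP[_ ind] bd; apply/andP; split; apply/forall_inP => // e eS.
apply/forall_inP => e' e'S; apply/implyP => ee'.
by have /forall_inP/(_ _ e'S) := forall_inP ind _ eS; rewrite ee'.
Qed.

Lemma proper_edge_coloringP t f :
  proper_edge_coloring t f <->
  (forall x y, adj x y -> 0 < f [set x; y] <= t) /\
  (forall x y z, adj x y -> adj x z -> y != z -> f [set x; y] != f [set x; z]).
Proof.
split=> [/andP[/forall_inP bd /forall_inP pr]|[bd pr]].
  split=> [x y xy|x y z xy xz yz]; first exact/bd/mem_edges.
  have /forall_inP/(_ _ (mem_edges xz))/implyP := pr _ (mem_edges xy).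
  apply; rewrite (@edge_adjP x) ?set21 //.
  by apply: contra yz => /eqP/set2_injr->.
apply/andP; split; apply/forall_inP => _ /edgesP[x [y [xy ->]]]; first exact: bd.
apply/forall_inP => e' e'E; apply/implyP => /andP[ne /pred0Pn[u /andP[/= ue ue']]].
have [v uv eE] := edges_mem (mem_edges xy) ue.
have [w uw e'w] := edges_mem e'E ue'.
by move: ne; rewrite eE e'w => ne; apply: pr => //; apply: contra ne => /eqP->.
Qed.

(** Edges are unordered, but explicit colorings are easier to define on ordered pairs; symmetry on
    adjacent pairs makes the passage to sets harmless. *)
Lemma pair_coloring t (g : G -> G -> nat) :
  (forall x y, adj x y -> g x y = g y x) ->
  (forall x y, adj x y -> 0 < g x y <= t) ->
  (forall x y z, adj x y -> adj x z -> y != z -> g x y != g x z) ->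
  exists f : {set G} -> nat, proper_edge_coloring t f /\
            forall x y, adj x y -> f [set x; y] = g x y.
Proof.
move=> gC bd pr.
(* The pick may return the ends of an edge in either order; 0 is a dummy value for sets that are not
   pairs. *)
pose f e := if [pick p : G * G | e == [set p.1; p.2]] is Some p
            then g p.1 p.2 else 0.
have fE x y : adj x y -> f [set x; y] = g x y.
  move=> xy; rewrite /f; case: pickP => [[u v] /= /eqP eq2|/(_ (x, y))]; last by rewrite /= eqxx.
  have: x \in [set u; v] by rewrite -eq2 set21.
  rewrite !inE => /orP[] /eqP xE; subst x; first by rewrite (set2_injr eq2).
  by move: eq2; rewrite (setUC [set u]) => /set2_injr yE; subst y; rewrite [RHS]gC.
exists f; split=> //; apply/proper_edge_coloringP; split=> [x y xy|x y z xy xz yz].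
  by rewrite fE ?bd.
by rewrite !fE ?pr.
Qed.

(** * Chromatic index and colorings that leave out one color *)

Lemma chromatic_indexP :
  exists f : {set G} -> nat, proper_edge_coloring (chromatic_index G) f.
Proof.
by apply/edge_colorableP; rewrite /chromatic_index; case: ex_minnP.
Qed.

Lemma max_degree_chromatic_index : max_degree G <= chromatic_index G.
Proof.
have [f /proper_edge_coloringP[bd pr]] := chromatic_indexP.
apply/bigmax_leqP => x _; rewrite /degree cardE.
rewrite -(size_map (fun y => f [set x; y])) -(size_iota 1 (chromatic_index G)).
apply: uniq_leq_size => [|_ /mapP[y + ->]]; last first.
  by rewrite mem_enum inE mem_iota add1n ltnS => /bd.
rewrite map_inj_in_uniq ?enum_uniq // => y z; rewrite !mem_enum !inE => xy xz.
by move=> /eqP; apply: contraTeq; apply: pr.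
Qed.

(* Since the precolored edges are independent, only the names of the colors
   matter, so that any chromatic_index G of the colors may be used. *)
Lemma extend_avoiding k c S (psi : {set G} -> nat) :
  (forall (S : {set {set G}}) (phi : {set G} -> nat),
     edge_precoloring (chromatic_index G) S phi ->
     independent_edges S -> #|S| <= k ->
     extendable (chromatic_index G) S phi) ->
  0 < c <= (chromatic_index G).+1 -> independent_edges S -> #|S| <= k ->
  (forall e, e \in S -> 0 < psi e <= (chromatic_index G).+1 /\ psi e != c) ->
  exists f : {set G} -> nat, [/\ proper_edge_coloring (chromatic_index G).+1 f,
                forall e, e \in edges G -> f e != c & {in S, f =1 psi}].
Proof.
move=> ext /andP[c0 ct] indS Sk bd; have /andP[subS _] := indS.
(* [unbump c] closes the gap that [c] leaves among the colors; [bump c] reopens it and never takes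
   the value [c]. *)
have [|f [/proper_edge_coloringP[fb fp] fS]] := ext S (fun e => unbump c (psi e)) _ indS Sk.
  split=> //; apply: proper_coloring_on_independent => // e /bd[/andP[p0 pt]].
  by rewrite /unbump neq_ltn => /orP[] ?; case: ltnP; lia.
exists (fun e => bump c (f e)); split=> [||e eS].
- apply/proper_edge_coloringP; split=> [x y /fb|x y z xy xz yz]; first by rewrite /bump; lia.
  by rewrite (inj_eq (can_inj (bumpK c))) fp.
- by move=> e _; rewrite eq_sym neq_bump.
- by rewrite fS // unbumpK // inE; case: (bd e eS).
Qed.

(** * Greedy matchings in triangle-free graphs *)

Lemma triangle_free_edge_nbrs x e :
  triangle_free G -> e \in edges G -> #|[set y in e | adj x y]| <= 1.
Proof.
move=> tf /edgesP[u [v [uv ->]]]; apply/card_le1_eqP => y z.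
rewrite !inE => /andP[yE xy] /andP[zE xz].
have vu : adj v u by rewrite adj_sym.
case/orP: yE => /eqP yE; case/orP: zE => /eqP zE; subst => //.
- by case: (tf x u v).
- by case: (tf x v u).
Qed.

(* Greedy choice: once x is matched to h x, the edge {x, h x} becomes an
   obstacle which, like any other, blocks at most one neighbor of each vertex. *)
Lemma matching_avoiding d (X : {set G}) (O : {set {set G}}) :
  triangle_free G -> (forall x, degree x = d) -> #|X| + #|O| <= d ->
  (forall e x, e \in O -> #|[set y in e | adj x y]| <= 1) ->
  (forall e x, e \in O -> x \in X -> x \notin e) ->
  exists h : G -> G,
    [/\ forall x, x \in X -> adj x (h x),
        forall x, x \in X -> h x \notin X,
        forall x e, x \in X -> e \in O -> h x \notin e
      & {in X &, injective h}].
Proof.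
(* [O] stays general: each step removes a vertex from [X] and adds one edge to [O], so the sum of
   the cardinals does not grow. *)
move=> tf reg; elim: {X}#|X| {-2}X (erefl #|X|) O => [|n IH] X cX O.
  by exists id; split=> x; rewrite (cards0_eq cX) inE.
move=> leD O1 OX; have /card_gt0P[x xX] : 0 < #|X| by rewrite cX.
have cX' : #|X :\ x| = n by have := cardsD1 x X; rewrite xX cX; lia.
(* At most [#|X| - 1] neighbors of [x] lie in [X :\ x], and each obstacle blocks at most one more;
   fewer than [d] are excluded. *)
have [y xy yXO] : exists2 y, adj x y & y \notin (X :\ x) :|: cover O.
  have: ~~ ([set y | adj x y] \subset
            (X :\ x) :|: \bigcup_(e in O) [set y in e | adj x y]).
    apply: contraL leD => /subset_leq_card; rewrite -ltnNge -/(degree x) reg => le.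
    apply: leq_ltn_trans le _; apply: leq_ltn_trans (leq_card_setU _ _) _.
    rewrite cX' cX ltnS leq_add2l.
    rewrite -[#|O|]sum1_card; elim/big_rec2: _ => [|e m A eO le]; first by rewrite cards0.
    by apply: leq_trans (leq_card_setU _ _) _; rewrite leq_add ?O1.
  case/subsetPn=> y; rewrite inE => xy yN; exists y => //.
  apply: contra yN; rewrite !in_setU => /orP[->//|/bigcupP[e eO ye]].
  by apply/orP; right; apply/bigcupP; exists e => //; rewrite inE ye.
move: yXO; rewrite in_setU negb_or => /andP[yX yO].
have yNO e : e \in O -> y \notin e.
  by move=> eO; apply: contra yO => ye; apply/bigcupP; exists e.
have [|||h [hadj hX hO hI]] := IH (X :\ x) cX' ([set x; y] |: O).
- by rewrite cardsU1; case: (_ \notin O); lia.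
- move=> e z; rewrite in_setU1 => /orP[/eqP->|]; last exact: O1.
  exact/triangle_free_edge_nbrs/mem_edges.
- move=> e z; rewrite in_setU1 => /orP[/eqP->|eO] zX; last first.
    by apply: OX => //; case/setD1P: zX.
  rewrite !inE negb_or; case/setD1P: (zX) => -> _ /=.
  by apply: contraNneq yX => <-.
have hxy z : z \in X :\ x -> (h z != x) && (h z != y).
  by move=> zX; have := hO z [set x; y] zX (setU11 _ _); rewrite !inE negb_or.
have DX z : z \in X -> z != x -> z \in X :\ x by rewrite !inE => -> ->.
exists (fun z => if z == x then y else h z); split=> [z zX|z zX|z e zX eO|z w zX wX].
- by case: eqP => [->|/eqP/(DX _ zX)/hadj].
- case: eqP => [_|/eqP/(DX _ zX) zX'].
    by apply: contra yX; rewrite !inE => ->; rewrite eq_sym (adj_neq xy).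
  have /andP[hx _] := hxy _ zX'; apply: contra (hX _ zX') => hzX.
  exact: DX.
- case: eqP => [_|/eqP/(DX _ zX) zX']; first exact: yNO.
  by apply: hO => //; rewrite setU1r.
- case: eqP => [->|/eqP/(DX _ zX) zX']; case: eqP => [->//|/eqP/(DX _ wX) wX'].
  + by move=> yE; have /andP[_] := hxy _ wX'; rewrite -yE eqxx.
  + by move=> yE; have /andP[_] := hxy _ zX'; rewrite yE eqxx.
  + exact: hI.
Qed.

End Graph.

(** * Edges and colorings of the prism over [G] *)

Section Prism.
Variable G : sgraph.
Implicit Types (x y : G) (e : {set G}) (i j : 'I_2) (E : {set G □ 'K_2}).

(** Rungs and layers are given by conditions on points, so that no order of the ends has to be
    chosen; [shadow] projects to [G] and recovers [x] (as a singleton) or [e]. *)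
Definition rung x : {set G □ 'K_2} := [set p : G * 'I_2 | p.1 == x].

Definition layer i e : {set G □ 'K_2} :=
  [set p : G * 'I_2 | (p.1 \in e) && (p.2 == i)].

Definition shadow E : {set G} := [set (p : G * 'I_2).1 | p in E].

Lemma mem_rung x y i : ((y, i) \in rung x) = (y == x).
Proof. by rewrite inE. Qed.

Lemma mem_layer i e y j : ((y, j) \in layer i e) = (y \in e) && (j == i).
Proof. by rewrite inE. Qed.

Lemma ord2_other i j j' : i != j -> i != j' -> j = j'.
Proof.
case: i j j' => [i ?] [j ?] [j' ?]; rewrite -!val_eqE /= => ? ?.
by apply: val_inj => /=; lia.
Qed.

Lemma rungE x i j : i != j -> rung x = [set ((x, i) : G □ 'K_2); (x, j)].
Proof.
move=> ij; apply/setP => -[y l]; rewrite mem_rung !inE !xpair_eqE -andb_orr.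
have [->|li] := eqVneq l i; first by rewrite andbT.
by rewrite (ord2_other ij (j' := l)) 1?eq_sym // eqxx andbT.
Qed.

Lemma layerE i x y :
  layer i [set x; y] = [set ((x, i) : G □ 'K_2); (y, i)].
Proof.
by apply/setP => -[z l]; rewrite mem_layer !inE !xpair_eqE andb_orl.
Qed.

Lemma shadow_rung x : shadow (rung x) = [set x].
Proof.
apply/setP => y; rewrite inE; apply/imsetP/eqP => [[[z l]]|->].
  by rewrite mem_rung => /eqP-> ->.
by exists (x, ord0); rewrite ?mem_rung.
Qed.

Lemma shadow_layer i e : shadow (layer i e) = e.
Proof.
apply/setP => y; apply/imsetP/idP => [[[z l]]|ye].
  by rewrite mem_layer => /andP[ze _] ->.
by exists (y, i); rewrite ?mem_layer ?ye ?eqxx.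
Qed.

Lemma rung_inj : injective rung.
Proof. by move=> x y /(congr1 shadow); rewrite !shadow_rung => /set1_inj. Qed.

Lemma layer_inj i : injective (layer i).
Proof. by move=> e e' /(congr1 shadow); rewrite !shadow_layer. Qed.

Lemma layer_neq_rung i e x : layer i e != rung x.
Proof.
apply/eqP => /setP eq2; have := eq2 (x, ord0); have := eq2 (x, ord_max).
by rewrite !mem_layer !mem_rung eqxx => /andP[_ /eqP<-] /andP[].
Qed.

Lemma adj_prism x y i j :
  adj ((x, i) : G □ 'K_2) (y, j) -> (x = y /\ i != j) \/ (i = j /\ adj x y).
Proof.
by case/orP => /= /andP[/eqP-> ?]; [left | right].
Qed.

Lemma edges_prism E : E \in edges (G □ 'K_2) ->
  (exists x, E = rung x) \/ (exists i e, e \in edges G /\ E = layer i e).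
Proof.
case/edgesP=> -[x i] [[y j] [/adj_prism[[-> ij]|[-> xy]] ->]].
  by left; exists y; rewrite (rungE _ ij).
by right; exists j, [set x; y]; rewrite layerE mem_edges.
Qed.

Lemma layer_edges i e : layer i e \in edges (G □ 'K_2) -> e \in edges G.
Proof.
case/edges_prism=> [[x /eqP]|[j [e' [e'E /(congr1 shadow)]]]].
  by rewrite (negPf (layer_neq_rung _ _ _)).
by rewrite !shadow_layer => ->.
Qed.

(* Starting from f i on layer i and c on the rungs, exchange the two colors on
   the 4-cycle above each edge of N. *)
Lemma prism_coloring t c (f : 'I_2 -> {set G} -> nat) (N : {set {set G}}) :
  0 < c <= t -> (forall i, proper_edge_coloring t (f i)) ->
  (forall i e, e \in edges G -> f i e != c) -> independent_edges N ->
  (forall i j e, e \in N -> f i e = f j e) ->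
  exists F : {set G □ 'K_2} -> nat,
    [/\ proper_edge_coloring t F,
        forall i e x, e \in N -> x \in e -> F (rung x) = f i e,
        forall x, (forall e, e \in N -> x \notin e) -> F (rung x) = c,
        forall i e, e \in N -> F (layer i e) = c
      & forall i e, e \in edges G -> e \notin N -> F (layer i e) = f i e].
Proof.
move=> ct fP fc indN fN; have /independent_edgesP[/subsetP subN uniqN] := indN.
have tN : trivIset N.
  apply/trivIsetP => e e' eN e'N; apply: contraNT => /pred0Pn[x /andP[/= xe xe']].
  by apply/eqP; apply: uniqN xe xe'.
have fb i := proj1 (proj1 (proper_edge_coloringP _ _) (fP i)).
have fp i := proj2 (proj1 (proper_edge_coloringP _ _) (fP i)).
(* Equal first components mean a rung. Above a vertex covered by [N] it takes the color of its edge
   of [N], for which [ord0] may stand since the [f i] agree on [N]. *)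
pose g (p q : G □ 'K_2) :=
  let: (x, i) := p in let: (y, j) := q in
  if x == y then (if x \in cover N then f ord0 (pblock N x) else c)
  else if [set x; y] \in N then c else f i [set x; y].
have pbN x : x \in cover N -> exists y, [/\ pblock N x \in N, adj x y & pblock N x = [set x; y]].
  move=> xN; have pN := pblock_mem xN.
  have xp : x \in pblock N x by rewrite mem_pblock.
  by have [y xy eE] := edges_mem (subN _ pN) xp; exists y.
have [||p q r|F [FP FE]] := @pair_coloring _ t g.
- move=> [x i] [y j] /adj_prism[[-> ij]|[-> xy]] /=; first by rewrite eqxx.
  by rewrite (eq_sym y) (negPf (adj_neq xy)) (setUC [set y]).
- move=> [x i] [y j] /adj_prism[[-> ij]|[-> xy]] /=.
    by rewrite eqxx; case: ifP => // /pbN[z [_ yz ->]]; apply: fb.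
  by rewrite (negPf (adj_neq xy)); case: ifP => // _; apply: fb.
(* On a rung [g] ignores the layers of its arguments, so [(x, i)] taken twice stands for the rung at
   [x]. *)
- have rung_layer x i z : adj x z -> g (x, i) (x, i) != g (x, i) (z, i).
    move=> xz; rewrite /= eqxx (negPf (adj_neq xz)).
    case: ifPn => [/pbN[y [yN xy yE]]|xN].
      case: ifPn => [_|zN]; first by rewrite fc ?subN.
      by rewrite (fN ord0 i) // yE fp //; apply: contraNneq zN => <-; rewrite -yE.
    case: ifPn => [zN|_]; last by rewrite eq_sym fc ?mem_edges.
    by case/negP: xN; apply/bigcupP; exists [set x; z]; rewrite ?set21.
  case: p q r => [x i] [y j] [z l] /adj_prism[[<- ij]|[<- xy]] /adj_prism[[<- il]|[<- xz]].
  + by rewrite (ord2_other ij il) eqxx.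
  + by move=> _; have := rung_layer x i z xz; rewrite /= eqxx.
  + by move=> _; rewrite eq_sym; have := rung_layer x i y xy; rewrite /= eqxx.
  rewrite xpair_eqE eqxx andbT /= (negPf (adj_neq xy)) (negPf (adj_neq xz)) => yz.
  case: ifPn => yN; case: ifPn => zN; last exact: fp.
  + have := uniqN _ _ x yN zN (set21 _ _) (set21 _ _).
    by move=> /set2_injr yzE; rewrite yzE eqxx in yz.
  + by rewrite eq_sym fc ?mem_edges.
  + by rewrite fc ?mem_edges.
have Frung x : F (rung x) = if x \in cover N then f ord0 (pblock N x) else c.
  rewrite (@rungE _ ord0 ord_max) // FE /= ?eqxx //.
  by apply/orP; left; rewrite eqxx.
have Flayer i e : e \in edges G -> F (layer i e) = if e \in N then c else f i e.
  case/edgesP=> x [y [xy ->]]; rewrite layerE FE /= ?(negPf (adj_neq xy)) //.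
  by apply/orP; right; rewrite eqxx.
exists F; split=> // [i e x eN xe|x xN|i e eN|i e eE eN].
- have xN : x \in cover N by apply/bigcupP; exists e.
  by rewrite Frung xN (def_pblock tN eN xe) (fN ord0 i).
- by rewrite Frung; case: bigcupP => // -[e /xN/negPf->].
- by rewrite Flayer ?eN ?subN.
- by rewrite Flayer ?(negPf eN).
Qed.

(** Both choices of [c] are treated at once: layer [i] receives the coloring built from the
    prescriptions of layer [sigma i], where [sigma] is the identity or constant. A precolored layer
    edge of color [c] requires an exchange, hence equal colorings in both layers: this is the last
    condition on [sigma]. *)
Lemma prism_extension d k c (sigma : 'I_2 -> 'I_2) S (phi : {set G □ 'K_2} -> nat) :
  triangle_free G -> (forall x, degree x = d) ->
  (forall (S : {set {set G}}) (phi : {set G} -> nat),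
     edge_precoloring (chromatic_index G) S phi ->
     independent_edges S -> #|S| <= k ->
     extendable (chromatic_index G) S phi) ->
  0 < c <= (chromatic_index G).+1 ->
  edge_precoloring (chromatic_index G).+1 S phi -> independent_edges S ->
  #|S| <= d ->
  (forall i, #|[set E in S | (phi E != c) &&
                 [exists p : G * 'I_2 in E, p.2 == sigma i]]| <= k) ->
  (forall i e, layer i e \in S -> sigma i = i) ->
  (forall i e, layer i e \in S -> phi (layer i e) = c -> forall j, sigma j = i) ->
  extendable (chromatic_index G).+1 S phi.
Proof.
move=> tf reg ext ct [_ /andP[/forall_inP phib _]] /independent_edgesP[/subsetP subS uniqS].
move=> Sd Uk sigS sigc.
have rung_layerN x i e : rung x \in S -> layer i e \in S -> x \notin e.
  move=> xS eS; apply: contraT; rewrite negbK => xe; have := layer_neq_rung i e x.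
  by rewrite (uniqS _ _ (x, i) eS xS) ?eqxx ?mem_layer ?mem_rung ?xe ?eqxx.
(* [X] collects the rungs that need an exchange. The obstacles in [O] are the shadows of all other
   precolored edges, including the rungs that must keep [c]. *)
pose X := [set x | (rung x \in S) && (phi (rung x) != c)].
pose O := [set e | [exists i, layer i e \in S]] :|:
          [set [set x] | x in [set x | (rung x \in S) && (phi (rung x) == c)]].
have XS x : x \in X -> rung x \in S by rewrite inE => /andP[].
have OX e x : e \in O -> x \in X -> x \notin e.
  move=> + xX; rewrite inE => /orP[|/imsetP[y yS ->]].
    by rewrite inE => /existsP[i]; apply/rung_layerN/XS.
  rewrite inE; apply/eqP => xy; move: xX yS.
  by rewrite !inE xy => /andP[_ /negPf->]; rewrite andbF.
have layerO i e : layer i e \in S -> e \in O.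
  by move=> eS; rewrite !inE; apply/orP; left; apply/existsP; exists i.
have [|e x|//|h [hadj hX hO hI]] := @matching_avoiding G d X O tf reg.
(* [X] and [O] come from disjoint parts of [S]. *)
- apply: leq_trans Sd; rewrite -(cardsID (rung @: X) S) leq_add //.
    rewrite (setIidPr _) ?card_imset //; first exact: rung_inj.
    by apply/subsetP => _ /imsetP[x /XS xS ->].
  apply: leq_trans (leq_imset_card shadow _); apply/subset_leq_card/subsetP => e.
  rewrite inE => /orP[|/imsetP[x + ->]]; rewrite inE.
    case/existsP=> i eS; apply/imsetP; exists (layer i e); last by rewrite shadow_layer.
    rewrite inE eS andbT; apply/imsetP => -[x _ /eqP].
    by rewrite (negPf (layer_neq_rung _ _ _)).
  case/andP=> xS xc; apply/imsetP; exists (rung x); last by rewrite shadow_rung.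
  rewrite inE xS andbT; apply/imsetP => -[y yX /rung_inj xy].
  by move: yX; rewrite -xy inE xc andbF.
- rewrite inE => /orP[|/imsetP[y _ ->]].
    by rewrite inE => /existsP[i /subS/layer_edges]; apply: triangle_free_edge_nbrs.
  rewrite -(cards1 y); apply/subset_leq_card/subsetP => z.
  by rewrite inE => /andP[].
pose M := [set [set x; h x] | x in X].
have memM x : x \in X -> [set x; h x] \in M by apply: imset_f.
have indM (L : {set {set G}}) :
    (forall e, e \in L -> exists i, layer i e \in S) ->
    (forall e e' x, e \in L -> e' \in L -> x \in e -> x \in e' -> e = e') ->
    independent_edges (M :|: L).
  move=> LS uniqL; have ML e e' x : e \in M -> e' \in L -> x \in e -> x \notin e'.
    case/imsetP=> y yX -> /LS[i /layerO e'O]; rewrite !inE => /orP[] /eqP->.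
      exact: OX.
    exact: hO.
  apply/independent_edgesP; split=> [|e e' x].
    apply/subsetP => e; rewrite inE => /orP[/imsetP[x xX ->]|/LS[i /subS/layer_edges//]].
    exact/mem_edges/hadj.
  rewrite !in_setU => /orP[eM|eL] /orP[e'M|e'L] xe xe'.
  - case/imsetP: eM xe => y yX ->; case/imsetP: e'M xe' => z zX -> ze ye.
    suff -> : y = z by [].
    move: ye ze; rewrite !inE => /orP[] /eqP-> /orP[] /eqP // yz.
    + by have := hX z zX; rewrite -yz yX.
    + by have := hX y yX; rewrite yz zX.
    + exact: hI.
  - by have := ML _ _ _ eM e'L xe; rewrite xe'.
  - by have := ML _ _ _ e'M eL xe'; rewrite xe.
  - exact: uniqL xe xe'.
(* The colors prescribed in layer [i]; the picked [x] is unique because [h x] lies outside [X]. *)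
pose psi i e := if [pick x in X | e == [set x; h x]] is Some x
                then phi (rung x) else phi (layer i e).
have psiX i x : x \in X -> psi i [set x; h x] = phi (rung x).
  move=> xX; rewrite /psi; case: pickP => [y /andP[yX /eqP eq2]|/(_ x)]; last first.
    by rewrite xX eqxx.
  suff -> : x = y by [].
  have: x \in [set y; h y] by rewrite -eq2 set21.
  rewrite !inE => /orP[] /eqP // xy; by have := hX y yX; rewrite -xy xX.
have psiL i e : layer i e \in S -> psi i e = phi (layer i e).
  move=> /layerO eO; rewrite /psi; case: pickP => // x /andP[xX /eqP eE].
  by have := OX _ _ eO xX; rewrite eE set21.
pose T i := M :|: [set e | (layer i e \in S) && (phi (layer i e) != c)].
have indT i : independent_edges (T i).
  apply: indM => [e|e e' x]; rewrite !inE => /andP[eS _]; first by exists i.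
  move=> /andP[e'S _] xe xe'; apply: (@layer_inj i).
  by apply: (uniqS _ _ (x, i)); rewrite // mem_layer ?xe ?xe' eqxx.
have Tk i : #|T (sigma i)| <= k.
  (* Every prescribed edge is the image under [r] of a precolored edge of color other than [c] that
     meets the layer. *)
  pose r E := if [pick x in X | E == rung x] is Some x then [set x; h x] else shadow E.
  apply: leq_trans (Uk i); apply: leq_trans (leq_imset_card r _).
  apply/subset_leq_card/subsetP => e; rewrite in_setU => /orP[/imsetP[x xX ->]|].
    apply/imsetP; exists (rung x); last first.
      rewrite /r; case: pickP => [y /andP[_ /eqP/rung_inj<-]//|/(_ x)].
      by rewrite xX eqxx.
    move: xX; rewrite !inE => /andP[-> ->] /=.
    by apply/existsP; exists (x, sigma i); rewrite mem_rung !eqxx.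
  rewrite inE => /andP[eS ec]; apply/imsetP; exists (layer (sigma i) e).
    rewrite inE eS ec /=; have /edgesP[x [y [_ eE]]] := layer_edges (subS _ eS).
    by apply/existsP; exists (x, sigma i); rewrite mem_layer eE set21 !eqxx.
  rewrite /r; case: pickP => [y /andP[_]|_]; last by rewrite shadow_layer.
  by rewrite (negPf (layer_neq_rung _ _ _)).
(* The bound on [T i] is available only for values of [sigma], hence the guard; the zero function is
   a dummy. *)
have /fin_all_exists[f fT] i : exists f : {set G} -> nat, #|T i| <= k ->
    [/\ proper_edge_coloring (chromatic_index G).+1 f,
        forall e, e \in edges G -> f e != c & {in T i, f =1 psi i}].
  have [Tik|_] := leqP #|T i| k; last by exists (fun=> 0).
  have [e|f fP] := extend_avoiding ext ct (indT i) Tik (psi := psi i); last by exists f.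
  rewrite in_setU => /orP[/imsetP[x xX ->]|].
    by rewrite psiX //; move: xX; rewrite inE => /andP[/phib ? ->].
  by rewrite inE => /andP[eS ec]; rewrite psiL //; split=> //; apply: phib.
(* Exchanging above [M] serves the rungs of [X]; exchanging above the other edges brings [c] into
   the layers. *)
pose N := M :|: [set e | [exists i, (layer i e \in S) && (phi (layer i e) == c)]].
have [|i|i e||i j e|F [FP Fin Fout FN FnN]] :=
  @prism_coloring (chromatic_index G).+1 c (f \o sigma) N => //=.
- by case: (fT _ (Tk i)).
- by case: (fT _ (Tk i)) => _ + _; apply.
- apply: indM => [e|e e' x].
    by rewrite inE => /existsP[i /andP[eS _]]; exists i.
  rewrite !inE => /existsP[i /andP[eS /eqP ec]] /existsP[j /andP[e'S /eqP e'c]] xe xe'.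
  have ij : i = j by rewrite -(sigc _ _ eS ec ord0) (sigc _ _ e'S e'c).
  subst j; apply: (@layer_inj i).
  by apply: (uniqS _ _ (x, i)); rewrite // mem_layer ?xe ?xe' eqxx.
- rewrite in_setU => /orP[/imsetP[x xX ->]|].
    have [_ _ fi] := fT _ (Tk i); have [_ _ fj] := fT _ (Tk j).
    by rewrite fi ?fj ?psiX // in_setU memM.
  by rewrite inE => /existsP[l /andP[eS /eqP ec]]; rewrite !(sigc _ _ eS ec).
exists F; split=> // E ES; have [[x Ex]|[i [e [eE Ee]]]] := edges_prism (subS _ ES).
  subst E; have [xc|xc] := eqVneq (phi (rung x)) c; last first.
    have xX : x \in X by rewrite inE ES.
    rewrite (Fin ord0 [set x; h x]) ?set21 ?in_setU ?memM //=.
    by have [_ _ ->] := fT _ (Tk ord0); rewrite ?psiX // in_setU memM.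
  rewrite Fout ?xc // => e; rewrite in_setU => /orP[/imsetP[y yX ->]|].
    rewrite !inE negb_or; apply/andP; split.
      by apply: contraTneq yX => <-; rewrite inE xc eqxx andbF.
    have := hO y [set x] yX; rewrite inE eq_sym; apply.
    by rewrite in_setU; apply/orP; right; apply: imset_f; rewrite inE ES xc eqxx.
  by rewrite inE => /existsP[i /andP[eS _]]; apply: rung_layerN eS.
subst E; have [ec|ec] := eqVneq (phi (layer i e)) c.
  rewrite FN ?ec // in_setU; apply/orP; right; rewrite inE.
  by apply/existsP; exists i; rewrite ES ec eqxx.
have si := sigS _ _ ES; rewrite FnN //=.
  have [_ _ ->] := fT _ (Tk i); rewrite si ?psiL //.
  by rewrite in_setU inE ES ec orbT.
rewrite in_setU negb_or; apply/andP; split.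
  apply/imsetP => -[x xX eX]; have := OX _ _ (layerO _ _ ES) xX.
  by rewrite eX set21.
(* A copy of [e] precolored [c] in layer [j] would force [sigma i = j], while [sigma i = i]; but the
   copy in layer [i] is not colored [c]. *)
rewrite inE; apply/existsP => -[j /andP[eS /eqP ejc]].
by move: ec; rewrite -si (sigc _ _ eS ejc i) ejc eqxx.
Qed.

End Prism.

(** * Choice of the color kept on the rungs *)

Unset Implicit Arguments.

Theorem theorem3p1 (G : sgraph) (k : nat) :
  triangle_free G ->
  regular G ->
  k < max_degree G ->
  (forall (S : {set {set G}}) (phi : {set G} -> nat),
     edge_precoloring (chromatic_index G) S phi ->
     independent_edges S -> #|S| <= k ->
     extendable (chromatic_index G) S phi) ->
  forall (S : {set {set G □ 'K_2}}) (phi : {set G □ 'K_2} -> nat),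
    edge_precoloring (chromatic_index G).+1 S phi ->
    independent_edges S -> #|S| <= k.+1 ->
    extendable (chromatic_index G).+1 S phi.
Proof.
move=> tf [d reg] kd ext S phi preS indS Sk.
have Sd : #|S| <= d.
  apply: leq_trans Sk (leq_trans kd _); apply/bigmax_leqP => x _; by rewrite reg.
(* One precolored edge that makes no demand on layer [i] lowers the count from [k.+1] to [k]. *)
have Uk c i E0 : E0 \in S ->
    phi E0 = c \/ (exists j e, j != i /\ E0 = layer j e) ->
    #|[set E in S | (phi E != c) && [exists p : G * 'I_2 in E, p.2 == i]]| <= k.
  move=> E0S E0c; rewrite -ltnS; apply: leq_trans Sk.
  apply/proper_card/properP; split; first by apply/subsetP => E; rewrite inE => /andP[].
  exists E0 => //; rewrite inE E0S /=.
  case: E0c => [->|[j [e [ji ->]]]]; first by rewrite eqxx.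
  rewrite negb_and; apply/orP; right; apply/existsP => -[[x l]].
  by rewrite mem_layer /= => /andP[/andP[_ /eqP->]]; rewrite (negPf ji).
(* Either both layers contain precolored edges or one contains none; empty [S] joins the first case,
   so that the second has an edge [E0] to supply [c]. *)
have [/forallP full|] :=
  boolP [forall i, (S == set0) || [exists e, layer i e \in S]].
  (* At most [k.+1] colors occur, and [k.+1 <= max_degree G <= chromatic_index G], so one color is
     free. *)
  have [c ct cS] : exists2 c, 0 < c <= (chromatic_index G).+1 & c \notin image phi S.
    have: ~~ all (mem (image phi S)) (iota 1 (chromatic_index G).+1).
      apply: contraL (leq_trans kd (max_degree_chromatic_index G)) => /allP sub.
      have := uniq_leq_size (iota_uniq _ _) sub; rewrite size_iota size_image => le.
      by rewrite -ltnNge; apply: leq_trans le Sk.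
    by case/allPn=> c; rewrite mem_iota => ? ?; exists c.
  have phiS E : E \in S -> phi E != c.
    by move=> ES; apply: contraNneq cS => <-; apply: image_f.
  apply: (@prism_extension G d k c id) => // [i|i e /phiS/eqP//].
  pose i' : 'I_2 := rev_ord i.
  have [/eqP->|/existsP[e eS]] := orP (full i').
    apply: leq_trans (leq0n k); rewrite leqn0 cards_eq0.
    by apply/eqP/setP => E; rewrite !inE.
  apply: (Uk c i _ eS); right; exists i', e; split=> //.
  by case: i @i' {eS} => [[|[|]]].
case/forallPn=> i'; rewrite negb_or => /andP[/set0Pn[E0 E0S] noE].
(* All precolored layer edges lie in the layer opposite to [i'], which therefore serves as the
   constant value of [sigma]. *)
have layS j e : layer j e \in S -> rev_ord i' = j.
  move=> eS; apply: (@ord2_other i'); first by case: i' {noE} => [[|[|]]].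
  by apply: contraNneq noE => ->; apply/existsP; exists e.
have [_ /andP[/forall_inP/(_ _ E0S) ct _]] := preS.
apply: (@prism_extension G d k (phi E0) (fun=> rev_ord i')) => // [i|i e /layS->//].
by apply: (Uk _ _ E0) => //; left.
Qed.
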